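(* Let $\mathbf{A}$ be a finite algebra, let $\alpha\prec\beta$ in $\mathrm{Con}(\mathbf{A})$, and suppose $U$ is an $\langle\alpha,\beta\rangle$-minimal set of type $\mathbf{i}$ (i.e., $\mathrm{typ}(\alpha,\beta)=\mathbf{i}$) which has nonempty tail. Then there is a subalgebra $\mathbf{S}\le\mathbf{A}^2$ whose congruence lattice contains a pentagon of type $\mathbf{i}$.
   Context: Tame congruence theory (Hobby–McKenzie). For a finite algebra $\mathbf{A}$ and covering $\alpha\prec\beta$ in $\mathrm{Con}(\mathbf{A})$, an $\langle\alpha,\beta\rangle$-minimal set is a set $U\subseteq A$ minimal under inclusion among sets $e(A)$, $e$ an idempotent unary polynomial of $\mathbf{A}$, with $\alpha|_U\neq\beta|_U$. A trace of $U$ is a $\beta|_U$-class that is not an $\alpha|_U$-class; the body is the union of the traces and the tail is $U$ minus the body. Types are the tame congruence theory labels $\mathbf{1},\dots,\mathbf{5}$. A pentagon $[\gamma,\delta,\theta]$ in a lattice is the five-element sublattice generated by $\gamma,\delta,\theta$ with $\delta<\theta$, $\gamma\vee\delta\ge\theta$, $\gamma\wedge\theta\le\delta$; a pentagon of type $\mathbf{i}$ (in the congruence lattice of a finite algebra) is one whose critical quotient $\langle\delta,\theta\rangle$ is a covering $\delta\prec\theta$ of type $\mathbf{i}$. *)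

(* Defs.v *)
From HB Require Import structures.
From mathcomp Require Import all_boot all_algebra.
Set Implicit Arguments. Unset Strict Implicit. Unset Printing Implicit Defensive.

Record alg_on (T : Type) : Type := AlgOn {
  idx : Type;
  ar : idx -> nat;
  fn : forall i : idx, ('I_(ar i) -> T) -> T }.
Arguments idx {T} a : rename.
Arguments ar {T a} i : rename.
Arguments fn {T a} i _ : rename.

Inductive term (T : Type) (s : alg_on T) (n : nat) : Type :=
| Var of 'I_n
| Cst of T
| App (i : idx s) of ('I_(ar i) -> term s n).

Fixpoint eval T (s : alg_on T) n (t : term s n) (x : 'I_n -> T) : T :=
  match t with
  | Var j => x j
  | Cst a => a
  | App i ts => fn i (fun j => eval (ts j) x)
  end.

Definition is_poly T (s : alg_on T) n (f : ('I_n -> T) -> T) : Prop :=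
  exists t : term s n, forall x, f x = eval t x.

Definition is_unary_poly T (s : alg_on T) (e : T -> T) : Prop :=
  is_poly s (fun x : 'I_1 -> T => e (x ord0)).

Definition poly_equiv T (s1 s2 : alg_on T) : Prop :=
  forall n (f : ('I_n -> T) -> T), is_poly s1 f <-> is_poly s2 f.

Definition transport T1 T2 (s : alg_on T1) (phi : T1 -> T2) (psi : T2 -> T1)
  : alg_on T2 :=
  @AlgOn T2 (idx s) (@ar _ s) (fun i x => phi (fn i (fun j => psi (x j)))).

Definition is_Gset T (s : alg_on T) : Prop :=
  forall i : idx s, exists e : ar i = 1,
    bijective (fun a : T => fn i (fun _ => a)).

Inductive vs_sig (F : Type) := VAdd | VNeg | VZero | VScale of F.
Definition vs_ar F (o : vs_sig F) : nat :=
  match o with VAdd => 2 | VNeg => 1 | VZero => 0 | VScale _ => 1 end.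
Definition vs_fn (F : pzRingType) (V : lmodType F) (o : vs_sig F)
  : ('I_(vs_ar o) -> V) -> V :=
  match o return ('I_(vs_ar o) -> V) -> V with
  | VAdd => fun x => (x ord0 + x ord_max)%R
  | VNeg => fun x => (- x ord0)%R
  | VZero => fun _ => 0%R
  | VScale a => fun x => (a *: x ord0)%R
  end.
Definition vs_alg (F : pzRingType) (V : lmodType F) : alg_on V :=
  @AlgOn V (vs_sig F) (@vs_ar F) (@vs_fn F V).

Inductive ba_sig := BJoin | BMeet | BCompl | BZero | BOne.
Definition ba_ar (o : ba_sig) : nat :=
  match o with BJoin | BMeet => 2 | BCompl => 1 | BZero | BOne => 0 end.
Definition ba_fn (o : ba_sig) : ('I_(ba_ar o) -> bool) -> bool :=
  match o return ('I_(ba_ar o) -> bool) -> bool with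
  | BJoin => fun x => x ord0 || x ord_max
  | BMeet => fun x => x ord0 && x ord_max
  | BCompl => fun x => ~~ x ord0
  | BZero => fun _ => false
  | BOne => fun _ => true
  end.
Definition bool_ba : alg_on bool := @AlgOn bool ba_sig ba_ar ba_fn.

Inductive lat_sig := LJoin | LMeet.
Definition lat_fn (o : lat_sig) : ('I_2 -> bool) -> bool :=
  match o with
  | LJoin => fun x => x ord0 || x ord_max
  | LMeet => fun x => x ord0 && x ord_max
  end.
Definition bool_lat : alg_on bool := @AlgOn bool lat_sig (fun _ => 2) lat_fn.

Definition bool_slat : alg_on bool :=
  @AlgOn bool unit (fun _ => 2) (fun _ x => x ord0 && x ord_max).

Inductive tct_type := tct1 | tct2 | tct3 | tct4 | tct5.

(* type of a minimal algebra: the class of Palfy's theorem it is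
   polynomially equivalent to *)
Definition has_tct_type T (s : alg_on T) (t : tct_type) : Prop :=
  match t with
  | tct1 => exists B : alg_on T, is_Gset B /\ poly_equiv s B
  | tct2 => exists (F : fieldType) (V : lmodType F) (phi : V -> T) (psi : T -> V),
      [/\ cancel phi psi, cancel psi phi & poly_equiv s (transport (vs_alg V) phi psi)]
  | tct3 => exists (phi : bool -> T) (psi : T -> bool),
      [/\ cancel phi psi, cancel psi phi & poly_equiv s (transport bool_ba phi psi)]
  | tct4 => exists (phi : bool -> T) (psi : T -> bool),
      [/\ cancel phi psi, cancel psi phi & poly_equiv s (transport bool_lat phi psi)]
  | tct5 => exists (phi : bool -> T) (psi : T -> bool),
      [/\ cancel phi psi, cancel psi phi & poly_equiv s (transport bool_slat phi psi)]
  end.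

Definition is_con (T : finType) (s : alg_on T) (C : {set T * T}) : Prop :=
  [/\ (forall x, (x, x) \in C),
      (forall x y, (x, y) \in C -> (y, x) \in C),
      (forall x y z, (x, y) \in C -> (y, z) \in C -> (x, z) \in C) &
      (forall (i : idx s) (x y : 'I_(ar i) -> T),
          (forall j, (x j, y j) \in C) -> (fn i x, fn i y) \in C)].

Definition covers (T : finType) (s : alg_on T) (al be : {set T * T}) : Prop :=
  [/\ is_con s al, is_con s be, al \proper be &
      forall C, is_con s C -> al \subset C -> C \subset be -> C = al \/ C = be].

Definition is_join (T : finType) (s : alg_on T) (g d J : {set T * T}) : Prop :=
  [/\ is_con s J, g \subset J, d \subset J &
      forall C, is_con s C -> g \subset C -> d \subset C -> J \subset C].

Definition poly_image (T : finType) (s : alg_on T) (U : {set T}) : Prop :=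
  exists e : T -> T,
    [/\ is_unary_poly s e, (forall x, e (e x) = e x) & U = e @: [set: T]].

Definition separates (T : finType) (al be : {set T * T}) (U : {set T}) : bool :=
  al :&: setX U U != be :&: setX U U.

Definition minimal_set (T : finType) (s : alg_on T) (al be : {set T * T})
    (U : {set T}) : Prop :=
  [/\ poly_image s U, separates al be U &
      forall V, poly_image s V -> separates al be V -> V \subset U -> V = U].

Definition is_trace (T : finType) (al be : {set T * T}) (U N : {set T}) : bool :=
  [exists x in U, (N == [set y in U | (x, y) \in be])
                  && (N != [set y in U | (x, y) \in al])].

Definition body (T : finType) (al be : {set T * T}) (U : {set T}) : {set T} :=
  \bigcup_(N : {set T} | is_trace al be U N) N.

Definition tail (T : finType) (al be : {set T * T}) (U : {set T}) : {set T} :=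
  U :\: body al be U.

Definition cls (T : finType) (al : {set T * T}) (N : {set T}) (z : T) : {set T} :=
  [set y in N | (z, y) \in al].

Definition isclass (T : finType) (al : {set T * T}) (N : {set T}) (C : {set T}) : bool :=
  [exists x in N, C == cls al N x].

Definition qcar (T : finType) (al : {set T * T}) (N : {set T}) :=
  {C : {set T} | isclass al N C}.

(* operations of A|_N: polynomials of A under which N is closed *)
Record ipoly (T : finType) (s : alg_on T) (N : {set T}) := IPoly {
  ip_n : nat;
  ip_f : ('I_ip_n -> T) -> T;
  ip_poly : is_poly s ip_f;
  ip_pres : forall x, (forall j, x j \in N) -> ip_f x \in N }.

Definition qrep (T : finType) (al : {set T * T}) (N : {set T}) (c : qcar al N) : T :=
  xchoose (elimT existsP (valP c)).

Lemma qrep_in (T : finType) (al : {set T * T}) (N : {set T}) (c : qcar al N) :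
  qrep c \in N.
Proof. by have /andP[] := xchooseP (elimT existsP (valP c)). Qed.

Lemma isclass_cls (T : finType) (al : {set T * T}) (N : {set T}) z :
  z \in N -> isclass al N (cls al N z).
Proof. by move=> Hz; apply/existsP; exists z; rewrite Hz eqxx. Qed.

Definition qop (T : finType) (s : alg_on T) (al : {set T * T}) (N : {set T})
    (p : ipoly s N) (c : 'I_(ip_n p) -> qcar al N) : qcar al N :=
  exist _ (cls al N (@ip_f _ _ _ p (fun j => qrep (c j))))
    (@isclass_cls _ al N _ (@ip_pres _ _ _ p _ (fun j => qrep_in (c j)))).

Definition induced_quot (T : finType) (s : alg_on T) (al : {set T * T})
    (N : {set T}) : alg_on (qcar al N) :=
  @AlgOn (qcar al N) (ipoly s N) (@ip_n T s N) (@qop T s al N).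

Definition min_set_type (T : finType) (s : alg_on T) (al be : {set T * T})
    (U : {set T}) (t : tct_type) : Prop :=
  exists N, is_trace al be U N /\ has_tct_type (induced_quot s al N) t.

Definition cover_type (T : finType) (s : alg_on T) (al be : {set T * T})
    (t : tct_type) : Prop :=
  exists U, minimal_set s al be U /\ min_set_type s al be U t.

Definition sq_alg T (s : alg_on T) : alg_on (T * T) :=
  @AlgOn (T * T) (idx s) (@ar _ s)
    (fun i x => (fn i (fun j => (x j).1), fn i (fun j => (x j).2))).

Definition is_subuniverse (T : finType) (s : alg_on T) (S : {set T}) : Prop :=
  forall (i : idx s) (x : 'I_(ar i) -> T), (forall j, x j \in S) -> fn i x \in S.

Definition sub_alg (T : finType) (s : alg_on T) (S : {set T})
    (HS : is_subuniverse s S) : alg_on {x : T | x \in S} :=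
  @AlgOn {x : T | x \in S} (idx s) (@ar _ s)
    (fun i x => exist _ (fn i (fun j => val (x j))) (HS i _ (fun j => valP (x j)))).

Definition pentagon_of_type (T : finType) (s : alg_on T) (ga de th : {set T * T})
    (t : tct_type) : Prop :=
  [/\ is_con s ga /\ is_con s de /\ is_con s th, de \proper th,
      ga :&: th \subset de &
      exists J, [/\ is_join s ga de J, th \subset J,
                    #|[set ga :&: de; ga; de; th; J]| = 5,
                    covers s de th & cover_type s de th t]].

(* Main.v *)
Require Import Defs.
From HB Require Import structures.
From mathcomp Require Import all_boot all_algebra.
From mathcomp Require Import fingroup perm.
From mathcomp Require Import boolp.
Set Implicit Arguments. Unset Strict Implicit. Unset Printing Implicit Defensive.

(** Let N be a trace of U and t an element of the tail. S is the subalgebra of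
    A^2 generated by the diagonal and N x {t}. The pentagon has
    ga = al x 1 and ga \/ de = be x 1; de is the largest congruence below
    be x be all of whose pairs inside N x N have al-related first coordinates,
    and th is generated by de and the pairs ((a,a),(b,b)) with a, b in N.

    The crux is that ((a,t),(b,t)) lies in de. Otherwise some polynomial
    P(x,y) of A with values in U and some tuple n in N have P(x,n) injective
    mod al on N while P(t,t,..,t) is in N; we may take P(x,n) = x on U. One
    finds a unary polynomial R(x) = P(x,k(x)) that is not collapsed on N mod al
    but has R(t) in N, which is absurd since then R permutes U and preserves
    the tail. In types 1 and 2, k is constant with value P(t,..,t) on N, fixes t
    mod al, and is P(t,P(t,x)); the term condition shows that R does not
    collapse. In types 4 and 5, k(x) = x works by monotonicity. In type 3 the
    meet and the join give k constant with any prescribed value on N and fixing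
    t mod al.

    The type of (de, th) is computed on a minimal set M inside U x U: a
    polynomial h maps the diagonal of N x N onto a trace of M, bijectively mod
    de, with a polynomial inverse, and carries the polynomials of A|_N to those
    of the trace. *)

Section Polynomials.
Variables (T : Type) (s : alg_on T).

Inductive pol (W : Type) : ((W -> T) -> T) -> Prop :=
| pol_var w : pol (fun x => x w)
| pol_cst a : pol (fun=> a)
| pol_app (i : idx s) (f : 'I_(ar i) -> (W -> T) -> T) :
    (forall j, pol (f j)) -> pol (fun x => fn i (fun j => f j x)).

Definition upol (f : T -> T) := pol (fun x : 'I_1 -> T => f (x ord0)).

Lemma is_polyE n (f : ('I_n -> T) -> T) : is_poly s f <-> pol f.
Proof.
split=> [[u /funext ->] | ].
  elim: u => [j|a|i us IH]; [exact: pol_var | exact: pol_cst | exact: pol_app].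
elim=> [j|a|i g _ IH]; [by exists (Var s j) | by exists (Cst s n a) | ].
have [us Hus] := choice IH.
by exists (App us) => x /=; congr (fn i _); apply: funext => j; rewrite Hus.
Qed.

Lemma upolE f : is_unary_poly s f <-> upol f.
Proof. exact: is_polyE. Qed.

Lemma pol_comp W W' (f : (W -> T) -> T) (g : W -> (W' -> T) -> T) :
  pol f -> (forall w, pol (g w)) -> pol (fun x => f (fun w => g w x)).
Proof.
move=> Hf Hg; elim: Hf => [w|a|i h _ IH]; [exact: Hg | exact: pol_cst | exact: pol_app].
Qed.

Lemma pol_reindex (W W' : Type) (r : W -> W') (r' : W' -> W) (f : (W' -> T) -> T) :
  cancel r' r -> pol (fun x => f (x \o r')) <-> pol f.
Proof.
move=> K; split=> Hf.
  have -> : f = fun y => f ((fun w => y (r w)) \o r').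
    by apply: funext => y; congr f; apply: funext => w /=; rewrite K.
  exact: (pol_comp (f := fun x => f (x \o r')) (g := fun w y => y (r w)) Hf (fun w => pol_var _)).
exact: (pol_comp (g := fun w x => x (r' w)) Hf (fun w => pol_var _)).
Qed.

Lemma upol_id : upol id. Proof. exact: pol_var. Qed.

Lemma upol_pol W f (g : (W -> T) -> T) : upol f -> pol g -> pol (fun x => f (g x)).
Proof. by move=> Hf Hg; apply: (pol_comp (g := fun _ => g) Hf). Qed.

Lemma upol_comp f g : upol f -> upol g -> upol (f \o g).
Proof. exact: upol_pol. Qed.

Lemma upol_iter n f : upol f -> upol (iter n f).
Proof.
by move=> Hf; elim: n => [|n IH]; [exact: upol_id | exact: (upol_comp Hf IH)].
Qed.

Lemma pol_upol W (f : (W -> T) -> T) (g : W -> T -> T) :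
  pol f -> (forall w, upol (g w)) -> upol (fun x => f (fun w => g w x)).
Proof. by move=> Hf Hg; apply: (pol_comp (g := fun w x => g w (x ord0)) Hf). Qed.

End Polynomials.

Lemma poly_equiv_pol T (s1 s2 : alg_on T) (W : finType) (f : (W -> T) -> T) :
  poly_equiv s1 s2 -> pol s1 f <-> pol s2 f.
Proof.
move=> E; rewrite -(pol_reindex s1 f (@enum_rankK W)).
by rewrite -(pol_reindex s2 f (@enum_rankK W)) -!is_polyE.
Qed.

Lemma poly_equivP T (s1 s2 : alg_on T) :
  poly_equiv s1 s2 <-> forall n (f : ('I_n -> T) -> T), pol s1 f <-> pol s2 f.
Proof. by split=> E n f; move: (E n f); rewrite !is_polyE. Qed.

Lemma pol_transport T1 T2 (s : alg_on T1) (phi : T1 -> T2) (psi : T2 -> T1) W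
    (f : (W -> T2) -> T2) :
  cancel phi psi -> cancel psi phi ->
  pol (transport s phi psi) f <-> pol s (fun x => psi (f (phi \o x))).
Proof.
move=> K1 K2; split.
  elim=> [w|a|i g _ IH].
  - rewrite (_ : (fun _ => _) = fun x => x w); first exact: pol_var.
    by apply: funext => x /=; rewrite K1.
  - exact: pol_cst.
  - rewrite (_ : (fun _ => _) = fun x => @fn _ s i (fun j => psi (g j (phi \o x)))).
      exact: (@pol_app _ s).
    by apply: funext => x /=; rewrite K1.
have lift g : pol s g -> pol (transport s phi psi) (fun y => phi (g (psi \o y))).
  elim=> [w|a|i h _ IH].
  - rewrite (_ : (fun _ => _) = fun x => x w); first exact: pol_var.
    by apply: funext => x /=; rewrite K2.
  - exact: pol_cst.
  - rewrite (_ : (fun _ => _) =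
      fun x => @fn _ (transport s phi psi) i (fun j => phi (h j (psi \o x)))).
      exact: (@pol_app _ (transport s phi psi)).
    apply: funext => x /=; congr (phi (fn i _)); apply: funext => j /=.
    by rewrite K1.
move=> /lift; congr pol; apply: funext => y; rewrite K2; congr f; apply: funext => w /=.
by rewrite K2.
Qed.

Lemma transport_comp T1 T2 T3 (s : alg_on T1) (f1 : T1 -> T2) g1 (f2 : T2 -> T3) g2 :
  transport (transport s f1 g1) f2 g2 = transport s (f2 \o f1) (g1 \o g2).
Proof. by []. Qed.

Lemma poly_equiv_trans T (s1 s2 s3 : alg_on T) :
  poly_equiv s1 s2 -> poly_equiv s2 s3 -> poly_equiv s1 s3.
Proof. by move=> E F n f; rewrite (E n f). Qed.

Lemma poly_equiv_transport T1 T2 (s s' : alg_on T1) (phi : T1 -> T2) psi :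
  cancel phi psi -> cancel psi phi ->
  poly_equiv s s' -> poly_equiv (transport s phi psi) (transport s' phi psi).
Proof.
move=> K1 K2 /poly_equivP E; apply/poly_equivP => n f.
by rewrite !(pol_transport _ _ K1 K2) E.
Qed.

Lemma has_tct_type_transport T1 T2 (s1 : alg_on T1) (s2 : alg_on T2) phi psi t :
  cancel phi psi -> cancel psi phi -> poly_equiv s2 (transport s1 phi psi) ->
  has_tct_type s1 t -> has_tct_type s2 t.
Proof.
move=> K1 K2 E.
have tr s : poly_equiv s1 s -> poly_equiv s2 (transport s phi psi).
  by move=> F; apply: poly_equiv_trans E _; apply: poly_equiv_transport.
case: t => /=.
- case=> B [GB /tr F]; exists (transport B phi psi); split=> // i.
  have [e [b b1 b2]] := GB i; exists e.
  exists (phi \o b \o psi) => a /=; first by rewrite K1 b1 K2.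
  by rewrite K1 (b2 (psi a)) K2.
- case=> F [V [f [g [L1 L2 /tr]]]]; rewrite transport_comp => G.
  by exists F, V, (phi \o f), (g \o psi); split=> //; exact: can_comp.
- case=> f [g [L1 L2 /tr]]; rewrite transport_comp => G.
  by exists (phi \o f), (g \o psi); split=> //; exact: can_comp.
- case=> f [g [L1 L2 /tr]]; rewrite transport_comp => G.
  by exists (phi \o f), (g \o psi); split=> //; exact: can_comp.
- case=> f [g [L1 L2 /tr]]; rewrite transport_comp => G.
  by exists (phi \o f), (g \o psi); split=> //; exact: can_comp.
Qed.

Section Congruences.
Variables (T : finType) (s : alg_on T).

Lemma con_pol C W (f : (W -> T) -> T) x y :
  is_con s C -> pol s f -> (forall w, (x w, y w) \in C) -> (f x, f y) \in C.
Proof. by case=> R _ _ O Hf H; elim: Hf => // i g _ IH; apply: O. Qed.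

Lemma con_upol C f x y : is_con s C -> upol s f -> (x, y) \in C -> (f x, f y) \in C.
Proof.
move=> HC Hf H; exact: (con_pol (x := fun=> x) (y := fun=> y) HC Hf (fun _ => H)).
Qed.

Lemma con_of_upol (C : {set T * T}) :
  (forall x, (x, x) \in C) -> (forall x y, (x, y) \in C -> (y, x) \in C) ->
  (forall x y z, (x, y) \in C -> (y, z) \in C -> (x, z) \in C) ->
  (forall f x y, upol s f -> (x, y) \in C -> (f x, f y) \in C) ->
  is_con s C.
Proof.
move=> R S Tr P; split=> // i x y H.
pose z k (j : 'I_(ar i)) := if j < k then y j else x j.
have step k : (fn i x, fn i (z k)) \in C.
  elim: k => [|k IH].
    by rewrite (_ : z 0 = x) //; apply: funext.
  apply: Tr IH _.
  case: (ltnP k (ar i)) => Hk; last first.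
    rewrite (_ : z k.+1 = z k) //; apply: funext => j; rewrite /z.
    by rewrite !(leq_trans (ltn_ord j)) // (leq_trans Hk).
  pose g u := fn i (fun j => if j == Ordinal Hk then u else z k j).
  have -> : z k = fun j => if j == Ordinal Hk then x (Ordinal Hk) else z k j.
    by apply: funext => j; case: eqP => // ->; rewrite /z /= ltnn.
  have -> : z k.+1 = fun j => if j == Ordinal Hk then y (Ordinal Hk) else z k j.
    apply: funext => j; case: eqP => [->|/eqP]; first by rewrite /z /= ltnSn.
    by rewrite -val_eqE /z /= ltnS leq_eqVlt => /negPf ->.
  apply: (P g) => //; apply: pol_app => j; case: (j == _); [exact: pol_var | exact: pol_cst].
have := step (ar i); rewrite (_ : z (ar i) = y) //.
by apply: funext => j; rewrite /z ltn_ord.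
Qed.

Definition separator (f : T -> T) (C : {set T * T}) : {set T * T} :=
  [set xy | `[< forall p, upol s p -> (f (p xy.1), f (p xy.2)) \in C >]].

Lemma separatorP f C x y :
  (x, y) \in separator f C <-> forall p, upol s p -> (f (p x), f (p y)) \in C.
Proof. by rewrite inE /=; split=> [/asboolP | H]; last exact/asboolP. Qed.

Lemma separator_con f C : is_con s C -> is_con s (separator f C).
Proof.
case=> R S Tr _; apply: con_of_upol.
- by move=> x; apply/separatorP.
- by move=> x y /separatorP H; apply/separatorP => p /H /S.
- move=> x y z /separatorP H /separatorP K; apply/separatorP => p Hp.
  by apply: (Tr _ (f (p y))); [exact: H | exact: K].
- move=> g x y Hg /separatorP H; apply/separatorP => p Hp.
  exact: (H (p \o g) (upol_comp Hp Hg)).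
Qed.

Lemma con_sub_separator f C : is_con s C -> upol s f -> C \subset separator f C.
Proof.
move=> HC Hf; apply/subsetP => -[x y] H; apply/separatorP => p Hp.
exact: (con_upol HC Hf (con_upol HC Hp H)).
Qed.

Lemma con_setI C D : is_con s C -> is_con s D -> is_con s (C :&: D).
Proof.
case=> R S Tr O [R' S' Tr' O']; split.
- by move=> x; rewrite inE R R'.
- by move=> x y; rewrite !inE => /andP[/S-> /S'->].
- move=> x y z; rewrite !inE => /andP[a b] /andP[c d].
  by apply/andP; split; [exact: Tr a c | exact: Tr' b d].
- move=> i x y H; rewrite inE; apply/andP.
  by split; [apply: O | apply: O'] => j; have := H j; rewrite inE => /andP[].
Qed.

Lemma minimal_cover al be C x y : covers s al be -> is_con s C -> al \subset C ->
  (x, y) \in C -> (x, y) \in be -> (x, y) \notin al -> be \subset C.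
Proof.
case=> Hal Hbe /properP [sab _] Hc HC aC xyC xyb xya.
have [] := Hc (C :&: be).
- exact: con_setI.
- by rewrite subsetI aC.
- exact: subsetIr.
- by move=> E; move: xya; rewrite -E inE xyC xyb.
- by move=> <-; exact: subsetIl.
Qed.

End Congruences.

Lemma iter_id_on (T : finType) (X : {set T}) (f : T -> T) :
  f @: X = X -> exists k, forall x, x \in X -> iter k.+1 f x = x.
Proof.
move=> fX.
have fX1 x : x \in X -> f x \in X by move=> Hx; rewrite -fX imset_f.
have finj : {in X &, injective f} by apply/imset_injP; rewrite fX.
pose g x := if x \in X then f x else x.
have ginj : injective g.
  move=> x y; rewrite /g; case: ifPn => Hx; case: ifPn => Hy // E.
  - exact: finj.
  - by move: Hy; rewrite -E fX1.
  - by move: Hx; rewrite E fX1.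
exists #[perm ginj]%g.-1 => x Hx; rewrite prednK ?order_gt0 //.
have : ((perm ginj) ^+ #[perm ginj])%g x = x by rewrite expg_order perm1.
rewrite permX; set n := #[_]%g.
suff -> : iter n (perm ginj) x = iter n f x by [].
suff: iter n (perm ginj) x = iter n f x /\ iter n f x \in X by case.
by elim: n => [|n [IH IH2]] //=; rewrite IH permE /g IH2 fX1.
Qed.

Section MinimalSets.
Variables (T : finType) (s : alg_on T) (al be : {set T * T}).
Hypothesis cov : covers s al be.

Lemma separatesP (X : {set T}) :
  reflect (exists x y, [/\ x \in X, y \in X, (x, y) \in be & (x, y) \notin al])
    (separates al be X).
Proof.
case: cov => _ _ /properP [/subsetP sab _] _.
apply: (iffP idP) => [|[x [y [xX yX Hb Ha]]]]; last first.
  apply/eqP => /setP /(_ (x, y)); rewrite !inE /= xX yX !andbT Hb.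
  by rewrite (negPf Ha).
rewrite /separates eqEsubset negb_and => /orP [] /subsetPn [[x y]].
  by rewrite !inE /= => /and3P [/sab -> -> ->].
rewrite !inE /= => /and3P [Hb xX yX]; rewrite xX yX !andbT => Ha.
by exists x, y.
Qed.

Variable U : {set T}.
Hypothesis minU : minimal_set s al be U.

Lemma noncollapsing_onto f a b : upol s f -> (forall x, f x \in U) ->
  a \in U -> b \in U -> (a, b) \in be -> (f a, f b) \notin al -> f @: U = U.
Proof.
have [[e [/upolE He ee ->]] _ Umin] := minU; set U0 := e @: _ in Umin *.
have [Hal Hbe /properP [sab _] _] := cov.
pose NC (g : {ffun T -> T}) := [/\ upol s g, forall x, g x \in U0 &
  exists a b, (a, b) \in be /\ (g a, g b) \notin al].
move=> Hf fU aU bU abb fab.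
have eU x : x \in U0 -> e x = x by case/imsetP => y _ ->.
have NCf : NC [ffun x => f (e x)].
  rewrite /NC (_ : ([ffun x => f (e x)] : T -> T) = f \o e); last first.
    by apply: funext => x; rewrite ffunE.
  split=> [||]; first exact: upol_comp.
    by move=> x /=.
  by exists a, b; rewrite /= !eU.
have [g /asboolP [Hg gU [a' [b' [Hb Ha]]]] gmin] :=
  @arg_minnP _ [ffun x => f (e x)] (fun g => `[< NC g >])
    (fun g : {ffun T -> T} => #|g @: [set: T]|) (asboolT NCf).
suff gT : g @: [set: T] = U0.
  have := gmin _ (asboolT NCf); rewrite gT => le.
  apply/eqP; rewrite eqEcard; apply/andP; split.
    by apply/subsetP => _ /imsetP [x _ ->].
  apply: leq_trans le _; apply: subset_leq_card; apply/subsetP => _ /imsetP [x _ ->].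
  by rewrite ffunE; apply: imset_f; apply: imset_f.
have [q Hq gqg] : exists2 q, upol s q & (g (q (g a')), g (q (g b'))) \notin al.
  apply: contrapT => H.
  have Hs : (g a', g b') \in separator s g al.
    apply/separatorP => p Hp; apply: contrapT => /negP K; apply: H.
    by exists p.
  have /subsetP /(_ _ Hb) /separatorP /(_ _ (@upol_id _ s)) K :=
    minimal_cover cov (separator_con g Hal) (con_sub_separator Hal Hg) Hs
      (con_upol Hbe Hg Hb) Ha.
  by rewrite K in Ha.
pose h := [ffun x => g (q (g x))].
have hE : (h : T -> T) = g \o q \o g by apply: funext => x; rewrite ffunE.
have NCh : NC h.
  rewrite /NC hE; split=> [||]; first by apply: upol_comp => //; apply: upol_comp.
    by move=> x /=.
  by exists a', b'.
pose R := g @: [set: T].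
have hR : h @: [set: T] = R.
  apply/eqP; rewrite eqEcard gmin ?andbT; last exact: asboolT.
  by apply/subsetP => _ /imsetP [x _ ->]; rewrite hE; apply: imset_f.
have /iter_id_on [k Hk] : (g \o q) @: R = R by rewrite -{2}hR hE [in RHS]imset_comp.
have iR x : iter k.+1 (g \o q) x \in R by apply: imset_f.
apply: Umin.
- exists (iter k.+1 (g \o q)); split.
  + by apply/upolE/upol_iter; apply: upol_comp.
  + by move=> x; apply: Hk.
  + apply/setP => y; apply/idP/imsetP => [yR|[x _ ->]]; last exact: iR.
    by exists y; rewrite ?Hk.
- apply/separatesP; exists (g a'), (g b').
  by split=> //; [exact: imset_f | exact: imset_f | exact: con_upol Hbe Hg Hb].
- by rewrite /R; apply/subsetP => _ /imsetP [x _ ->].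
Qed.

(* [iter k f] is a polynomial inverse of [f] on [U]. *)
Lemma noncollapsing_inv f a b : upol s f -> (forall x, f x \in U) ->
  a \in U -> b \in U -> (a, b) \in be -> (f a, f b) \notin al ->
  exists k, forall x, x \in U -> iter k.+1 f x = x.
Proof.
move=> Hf fU aU bU Hb Ha; apply: iter_id_on.
exact: noncollapsing_onto aU bU Hb Ha.
Qed.

End MinimalSets.

Section InducedQuotient.
Variables (T : finType) (s : alg_on T) (al : {set T * T}) (N : {set T}).
Hypothesis Hal : is_con s al.

Definition qcls x (Hx : x \in N) : qcar al N := exist _ (cls al N x) (isclass_cls al Hx).

Lemma eq_cls x y : x \in N -> y \in N -> (cls al N x == cls al N y) = ((x, y) \in al).
Proof.
case: Hal => R S Tr _ xN yN; apply/eqP/idP => [/setP /(_ y)|xy].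
  by rewrite !inE yN R.
apply/setP => z; rewrite !inE; case: (z \in N) => //=.
by apply/idP/idP; apply: Tr => //; apply: S.
Qed.

Lemma cls_qrep (c : qcar al N) : cls al N (qrep c) = val c.
Proof. by have /andP[_ /eqP] := xchooseP (elimT existsP (valP c)). Qed.

Lemma qcls_eq x y (Hx : x \in N) (Hy : y \in N) :
  (x, y) \in al <-> qcls Hx = qcls Hy.
Proof.
rewrite -(eq_cls Hx Hy); split=> [/eqP E|E]; first exact: val_inj.
exact/eqP/(congr1 val E).
Qed.

Lemma qcls_qrep (c : qcar al N) : qcls (qrep_in c) = c.
Proof. by apply: val_inj; rewrite /= cls_qrep. Qed.

Lemma qrep_qcls x (Hx : x \in N) : (qrep (qcls Hx), x) \in al.
Proof. by apply/(qcls_eq (qrep_in _) Hx); rewrite qcls_qrep. Qed.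

Lemma pol_quotP W (f : (W -> qcar al N) -> qcar al N) :
  pol (induced_quot s al N) f ->
  exists2 p, pol s p & exists pN : forall x : W -> T, (forall w, x w \in N) -> p x \in N,
    forall c, f c = qcls (pN (fun w => qrep (c w)) (fun w => qrep_in (c w))).
Proof.
elim=> [w|a|i g _ IH].
- exists (fun x => x w); first exact: pol_var.
  by exists (fun x H => H w) => c; rewrite qcls_qrep.
- exists (fun=> qrep a); first exact: pol_cst.
  by exists (fun _ _ => qrep_in a) => c; rewrite qcls_qrep.
- have {}IH j : exists p, pol s p /\ exists pN : forall x : W -> T, (forall w, x w \in N) -> p x \in N,
    forall c, g j c = qcls (pN (fun w => qrep (c w)) (fun w => qrep_in (c w))).
    by have [p Hp Hp'] := IH j; exists p.
  have [p Hp] := choice IH.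
  have Hi := ip_poly i; rewrite is_polyE in Hi.
  exists (fun x => @ip_f _ _ _ i (fun j => p j x)).
    by apply: (pol_comp (g := p)) => // j; case: (Hp j).
  have pN (x : W -> T) : (forall w, x w \in N) -> @ip_f _ _ _ i (fun j => p j x) \in N.
    by move=> xN; apply: ip_pres => j; have [_ [+ _]] := Hp j; apply.
  exists pN => c; apply/qcls_eq => /=; apply: con_pol Hi _ => // j.
  by have [_ [pjN ->]] := Hp j; apply: qrep_qcls.
Qed.

Lemma pol_quot (W : finType) (p : (W -> T) -> T)
    (pN : forall x, (forall w, x w \in N) -> p x \in N) : pol s p ->
  pol (induced_quot s al N)
    (fun c : W -> qcar al N => qcls (pN (fun w => qrep (c w)) (fun w => qrep_in (c w)))).
Proof.
move=> Hp.
pose p' (x : 'I_#|W| -> T) := p (x \o enum_rank).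
have p'N x : (forall j, x j \in N) -> p' x \in N by move=> H; apply: pN => w /=.
have Hp' : is_poly s p'.
  apply/is_polyE.
  exact: (pol_comp (g := fun w (x : 'I_#|W| -> T) => x (enum_rank w)) Hp (fun w => pol_var _ _)).
pose ip := IPoly Hp' p'N.
have := @pol_app _ (induced_quot s al N) W ip (fun j c => c (enum_val j))
  (fun j => pol_var _ _).
congr pol; apply: funext => c; apply: val_inj => /=; congr (cls _ _ _).
by rewrite /p'; congr p; apply: funext => w /=; rewrite enum_rankK.
Qed.

End InducedQuotient.

Section TypeProperties.
Variables (Q : Type) (s : alg_on Q).

Definition join_args (W V : Type) (x : W -> Q) (z : V -> Q) (w : W + V) : Q :=
  match w with inl w => x w | inr v => z v end.

(* Types 1 and 2 *)
Definition term_condition := forall (V : finType) (f : ('I_1 + V -> Q) -> Q) c c' z z',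
  pol s f -> f (join_args (fun=> c) z) = f (join_args (fun=> c') z) ->
  f (join_args (fun=> c) z') = f (join_args (fun=> c') z').

(* Types 4 and 5, by monotonicity *)
Definition diagonal_dependence := forall (V : finType) (f : ('I_1 + V -> Q) -> Q) c c' z,
  pol s f -> f (join_args (fun=> c) z) <> f (join_args (fun=> c') z) ->
  f (fun=> c) <> f (fun=> c').

(* Type 3 *)
Definition absorbing_products := forall c : Q, exists c' (p : (bool -> Q) -> Q),
  [/\ pol s p, forall y, p (fun b => if b then y else c) = c &
      forall y, p (fun b => if b then y else c') = y].

Lemma monotone_diagonal (psi : Q -> bool) (phi : bool -> Q) : cancel psi phi ->
  (forall (W : finType) (f : (W -> Q) -> Q) x y, pol s f ->
    (forall w, psi (x w) ==> psi (y w)) -> psi (f x) ==> psi (f y)) ->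
  diagonal_dependence.
Proof.
move=> K mono V f.
have main c c' z : pol s f -> psi c = false -> psi c' = true ->
    f (join_args (fun=> c) z) <> f (join_args (fun=> c') z) -> f (fun=> c) <> f (fun=> c').
  move=> Hf p0 p1 ne E; apply: ne; apply: (can_inj K).
  have: psi (f (join_args (fun=> c) z)) ==> psi (f (join_args (fun=> c') z)).
    by apply: mono => // -[w|v] /=; rewrite ?p0 ?implybb.
  have: psi (f (fun=> c)) ==> psi (f (join_args (fun=> c) z)).
    by apply: mono => // -[w|v] /=; rewrite p0.
  have: psi (f (join_args (fun=> c') z)) ==> psi (f (fun=> c')).
    by apply: mono => // -[w|v] /=; rewrite p1 implybT.
  by rewrite E; do 3!case: (psi _).
move=> c c' z Hf ne.
case E: (psi c); case E': (psi c').
- by case: ne; have -> : c = c' by rewrite -(K c) -(K c') E E'.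
- by move/esym; apply: (main c' c z) => // /esym.
- exact: (main c c' z).
- by case: ne; have -> : c = c' by rewrite -(K c) -(K c') E E'.
Qed.

Lemma type_properties t : has_tct_type s t ->
  [\/ term_condition, diagonal_dependence | absorbing_products].
Proof.
case: t => /=.
- case=> B [GB E]; apply: Or31 => V f c c' z z' /(poly_equiv_pol _ E).
  elim=> [w|a|i g _ IH] //; first by case: w.
  have [e [h hK _]] := GB i.
  pose j0 : 'I_(ar i) := cast_ord (esym e) ord0.
  have one (x : 'I_(ar i) -> Q) : x = fun=> x j0.
    apply: funext => j; congr x; apply: val_inj => /=.
    by have := ltn_ord j; rewrite {2}e ltnS leqn0 => /eqP.
  rewrite (one (fun j => g j _)) [X in _ = fn i X -> _](one (fun j => g j _)).
  move/(can_inj hK)/IH => K.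
  by rewrite (one (fun j => g j _)) K -(one (fun j => g j _)).
- case=> F [V0 [phi [psi [K1 K2 E]]]]; apply: Or31 => V f c c' z z'.
  move=> /(poly_equiv_pol _ E) Hf eq; apply: (can_inj K2).
  apply/eqP; rewrite -GRing.subr_eq0.
  suff -> : (psi (f (join_args (fun=> c) z')) - psi (f (join_args (fun=> c') z')) =
    psi (f (join_args (fun=> c) z)) - psi (f (join_args (fun=> c') z)))%R.
    by rewrite eq GRing.subrr.
  elim: Hf {eq} => [[w|v]|a|[|||k] g _ IH] //=; rewrite ?GRing.subrr ?K1 //.
  + by rewrite !GRing.opprD GRing.addrACA !IH GRing.addrACA.
  + by rewrite -!GRing.opprD IH.
  + by rewrite -!GRing.scalerBr IH.
- case=> phi [psi [K1 K2 E]]; apply: Or33 => c.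
  have app o : pol s (fun x : bool -> Q => @fn _ (transport bool_ba phi psi) o (fun j => x (j == 0 :> nat))).
    by apply/(poly_equiv_pol _ E)/pol_app => j; apply: pol_var.
  case Ec: (psi c); [exists (phi false), (fun x => phi (psi (x true) || psi (x false))) |
                     exists (phi true), (fun x => phi (psi (x true) && psi (x false)))].
    by split=> [|y|y]; [exact: (app BJoin) | rewrite Ec orbT -Ec K2 | rewrite K1 orbF K2].
  by split=> [|y|y]; [exact: (app BMeet) | rewrite Ec andbF -Ec K2 | rewrite K1 andbT K2].
- case=> phi [psi [K1 K2 E]]; apply: Or32; apply: (monotone_diagonal K2).
  move=> W f x y /(poly_equiv_pol _ E) Hf H.
  elim: Hf => [w|a|[] g _ IH] //=; rewrite ?implybb // !K1.
  + by have := IH ord0; have := IH ord_max;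
      do 4!case: (psi _).
  + by have := IH ord0; have := IH ord_max;
      do 4!case: (psi _).
- case=> phi [psi [K1 K2 E]]; apply: Or32; apply: (monotone_diagonal K2).
  move=> W f x y /(poly_equiv_pol _ E) Hf H.
  elim: Hf => [w|a|[] g _ IH] //=; rewrite ?implybb // !K1.
  by have := IH ord0; have := IH ord_max; do 4!case: (psi _).
Qed.
End TypeProperties.

Section Tail.
Variables (T : finType) (s : alg_on T) (al be : {set T * T}) (U N : {set T}) (t : T).
Hypotheses (cov : covers s al be) (minU : minimal_set s al be U).
Hypotheses (trN : is_trace al be U N) (tail_t : t \in tail al be U).

Let Hal : is_con s al. Proof. by case: cov. Qed.
Let Hbe : is_con s be. Proof. by case: cov. Qed.
Let albe x y : (x, y) \in al -> (x, y) \in be.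
Proof. by case: cov => _ _ /properP [/subsetP sab _] _ /sab. Qed.
Let alS x y : (x, y) \in al -> (y, x) \in al. Proof. by case: Hal => _ + _ _; apply. Qed.
Let alT x y z : (x, y) \in al -> (y, z) \in al -> (x, z) \in al.
Proof. by case: Hal => _ _ + _; apply. Qed.
Let beR x : (x, x) \in be. Proof. by case: Hbe => + _ _ _; apply. Qed.
Let beS x y : (x, y) \in be -> (y, x) \in be. Proof. by case: Hbe => _ + _ _; apply. Qed.
Let beT x y z : (x, y) \in be -> (y, z) \in be -> (x, z) \in be.
Proof. by case: Hbe => _ _ + _; apply. Qed.

Lemma trace_sub x : x \in N -> x \in U.
Proof. by case/existsP: trN => y /andP [_ /andP [/eqP -> _]]; rewrite inE => /andP []. Qed.

Lemma trace_be x y : x \in N -> y \in N -> (x, y) \in be.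
Proof.
case/existsP: trN => z /andP [_ /andP [/eqP -> _]]; rewrite !inE.
by move=> /andP [_ xz] /andP [_]; apply/beT/beS.
Qed.

Lemma trace_closed x y : x \in N -> y \in U -> (x, y) \in be -> y \in N.
Proof.
case/existsP: trN => z /andP [_ /andP [/eqP -> _]]; rewrite !inE.
by move=> /andP [_ xz] -> /= /(beT xz).
Qed.

Lemma trace_nontrivial : exists a b, [/\ a \in N, b \in N & (a, b) \notin al].
Proof.
case/existsP: trN => x /andP [xU /andP [/eqP NE]].
rewrite NE eqEsubset negb_and => /orP [] /subsetPn [y]; rewrite !inE => /andP [yU].
  move=> xy; rewrite yU /= => n; exists x, y.
  by rewrite !inE xU yU beR.
by move=> /albe xy; rewrite yU xy.
Qed.

Lemma tail_in : t \in U. Proof. by move: tail_t; rewrite inE => /andP []. Qed.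

Lemma tail_al y : y \in U -> (t, y) \in be -> (t, y) \in al.
Proof.
move=> yU tb; apply: contraT => n; move: tail_t; rewrite inE.
case/andP => /negP nb _; case: nb; have tU := tail_in; apply/bigcupP; exists [set y in U | (t, y) \in be]; last by rewrite inE tU beR.
apply/existsP; exists t; rewrite tU eqxx /=; apply/eqP => /setP /(_ y).
by rewrite !inE yU tb (negPf n).
Qed.

Lemma tail_trace_be x : x \in N -> (t, x) \notin be.
Proof.
move=> xN; apply/negP => tx; have [a [b [aN bN /negP[]]]] := trace_nontrivial.
have ta y : y \in N -> (t, y) \in al.
  by move=> yN; apply: tail_al (trace_sub yN) (beT tx (trace_be xN yN)).
exact: alT (alS (ta _ aN)) (ta _ bN).
Qed.

Lemma iter_range f k x : (forall y, f y \in U) -> x \in U -> iter k f x \in U.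
Proof. by move=> fU xU; case: k => //= k. Qed.

Lemma trace_stable f a : upol s f -> (forall y, f y \in U) -> a \in N -> f a \in N ->
  forall k x, x \in N -> iter k f x \in N.
Proof.
move=> Hf fU aN faN; elim=> [|k IH] x xN //=.
by apply: trace_closed faN (fU _) (con_upol Hbe Hf (trace_be aN (IH _ xN))).
Qed.

(* A noncollapsing [R] would permute [U], hence map tail to tail. *)
Lemma tail_to_trace_collapses R a b : upol s R -> (forall x, R x \in U) -> R t \in N ->
  a \in N -> b \in N -> (R a, R b) \in al.
Proof.
move=> HR RU RtN aN bN; apply: contraT => Rab.
have [k Hk] := noncollapsing_inv cov minU HR RU (trace_sub aN) (trace_sub bN)
  (trace_be aN bN) Rab.
have [u [uN /negP[]]] : exists u, u \in N /\ (R t, u) \notin al.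
  have [c [d [cN dN cd]]] := trace_nontrivial.
  have [Rc|Rc] := boolP ((R t, c) \in al); last by exists c.
  exists d; split=> //; apply/negP => /(alT (alS Rc)); exact/negP.
rewrite -(Hk u (trace_sub uN)) iterS; apply: (con_upol Hal HR).
apply: tail_al; first exact: iter_range (trace_sub uN).
rewrite -{1}(Hk t tail_in) iterSr; apply: (con_upol Hbe (upol_iter k HR)).
exact: trace_be.
Qed.

Variable ty : tct_type.
Hypothesis Hty : has_tct_type (induced_quot s al N) ty.

Section NormalizedObstruction.
Variables (V : finType) (Q : ('I_1 + V -> T) -> T) (z : V -> T).
Hypotheses (HQ : pol s Q) (QU : forall x, Q x \in U) (zN : forall v, z v \in N).
Hypotheses (Qid : forall x, x \in U -> Q (join_args (fun=> x) z) = x).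
Hypothesis (Qt : Q (fun=> t) \in N).

Let ja c (y : V -> T) : 'I_1 + V -> T := join_args (fun=> c) y.

Let Qbe c c' y y' : (c, c') \in be -> (forall v, (y v, y' v) \in be) ->
  (Q (ja c y), Q (ja c' y')) \in be.
Proof. by move=> H K; apply: (con_pol _ HQ) => // -[w|v] /=. Qed.

Let Qal c c' y y' : (c, c') \in al -> (forall v, (y v, y' v) \in al) ->
  (Q (ja c y), Q (ja c' y')) \in al.
Proof. by move=> H K; apply: (con_pol _ HQ) => // -[w|v] /=. Qed.

Let alR x : (x, x) \in al. Proof. by case: Hal => + _ _ _; apply. Qed.

Let QN x : (forall w, x w \in N) -> Q x \in N.
Proof.
move=> xN; have [a [_ [aN _ _]]] := trace_nontrivial.
apply: (trace_closed aN) => //; rewrite -(Qid (trace_sub aN)).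
by apply: (con_pol _ HQ) => // -[w|v] /=; apply: trace_be.
Qed.

Let Qja x : Q (ja x (fun=> x)) = Q (fun=> x).
Proof. by congr Q; apply: funext; case. Qed.

Let Qt_tail y : (forall v, y v \in N) -> (t, Q (ja t y)) \in al.
Proof.
move=> yN; apply: tail_al => //; rewrite -{1}(Qid tail_in).
by apply: Qbe => // v; apply: trace_be.
Qed.

Let upolQ g (h : V -> T -> T) : upol s g -> (forall v, upol s (h v)) ->
  upol s (fun x => Q (ja (g x) (fun v => h v x))).
Proof.
move=> Hg Hh.
have := pol_comp (g := fun w (x : 'I_1 -> T) =>
  match w with inl _ => g (x ord0) | inr v => h v (x ord0) end) HQ.
rewrite /upol (_ : (fun x => Q _) = fun x => Q (ja (g (x ord0)) (fun v => h v (x ord0)))).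
  by apply=> -[].
by apply: funext => x; congr Q; apply: funext; case.
Qed.

(* If every constant of [N] in [z] can be replaced by a polynomial that is
   constant mod [al] on [N] but fixes [t], the result sends [t] into the trace. *)
Let substitution_absurd (k : V -> T -> T) a b : (forall v, upol s (k v)) ->
  (forall v, (t, k v t) \in al) -> a \in N -> b \in N ->
  (Q (ja a (k^~ a)), Q (ja b (k^~ b))) \in al.
Proof.
move=> Hk kt; apply: (tail_to_trace_collapses (upolQ (upol_id s) Hk)) => //.
apply: trace_closed Qt (QU _) _; apply: albe; rewrite -Qja.
by apply: Qal.
Qed.

Let quotQ := pol_quot al QN HQ.

Let rep c y (cN : c \in N) (yN : forall v, y v \in N) :
  (Q (fun w => qrep (join_args (fun=> qcls al cN) (fun v => qcls al (yN v)) w)),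
   Q (ja c y)) \in al.
Proof. by apply: (con_pol Hal HQ) => -[w|v] /=; apply: (qrep_qcls Hal). Qed.

Lemma term_condition_absurd : term_condition (induced_quot s al N) -> False.
Proof.
move=> TC; pose m := Q (fun=> t); have mN : m \in N := Qt.
pose k (v : V) x := Q (ja t (fun=> Q (ja t (fun=> x)))).
have kN v x : x \in N -> (m, k v x) \in al.
  by move=> xN; rewrite /m -Qja; apply: Qal => // _; apply: Qt_tail.
have kt v : (t, k v t) \in al.
  by rewrite /k [Q (ja t (fun=> t))]Qja; apply: Qt_tail.
have Hk v : upol s (k v).
  by apply: (@upolQ (fun=> t)) => [|_]; [exact: pol_cst | apply: (@upolQ (fun=> t));
    [exact: pol_cst | move=> _; exact: upol_id]].
have col a b : a \in N -> b \in N -> (Q (ja a (fun=> m)), Q (ja b (fun=> m))) \in al.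
  move=> aN bN; have H := substitution_absurd Hk kt aN bN.
  have E c : c \in N -> (Q (ja c (fun=> m)), Q (ja c (k^~ c))) \in al.
    by move=> cN; apply: Qal => // v; apply: kN.
  exact: alT (E _ aN) (alT H (alS (E _ bN))).
have [a [b [aN bN /negP[]]]] := trace_nontrivial.
have := TC _ _ (qcls al aN) (qcls al bN) (fun=> qcls al mN) (fun v => qcls al (zN v)) quotQ.
rewrite -!(qcls_eq Hal) => H.
have := H (alT (@rep a (fun=> m) aN (fun=> mN)) (alT (col _ _ aN bN) (alS (@rep b (fun=> m) bN (fun=> mN))))).
move=> H1; have := alT (alS (rep aN zN)) (alT H1 (rep bN zN)).
by rewrite !Qid ?trace_sub.
Qed.

Lemma diagonal_dependence_absurd : diagonal_dependence (induced_quot s al N) -> False.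
Proof.
move=> DD.
have [a [b [aN bN /negP[]]]] := trace_nontrivial.
have := substitution_absurd (fun _ => upol_id s) (fun _ => alR t) aN bN.
rewrite !Qja => diag; apply: contrapT => ab.
have rep' c (cN : c \in N) : (Q (fun=> qrep (qcls al cN)), Q (fun=> c)) \in al.
  by apply: (con_pol Hal HQ) => w; apply: (qrep_qcls Hal).
apply: (DD _ _ (qcls al aN) (qcls al bN) (fun v => qcls al (zN v)) quotQ).
  move=> /(qcls_eq Hal) H; apply: ab.
  have := alT (alS (rep aN zN)) (alT H (rep bN zN)).
  by rewrite !Qid ?trace_sub.
apply/(qcls_eq Hal); exact: alT (rep' _ aN) (alT diag (alS (rep' _ bN))).
Qed.

Lemma absorbing_products_absurd : absorbing_products (induced_quot s al N) -> False.
Proof.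
move=> AP.
have [[e [/upolE He ee UE]] _ _] := minU.
have eU x : e x \in U by rewrite UE; apply: imset_f.
have eid x : x \in U -> e x = x by rewrite UE => /imsetP [y _ ->].
have Hk v : exists k, [/\ upol s k, (t, k t) \in al & forall x, x \in N -> (z v, k x) \in al].
  have [c' [f [/(pol_quotP Hal) [p Hp [pN fE]] fc fc']]] := AP (qcls al (zN v)).
  pose p2 n y := p (fun b : bool => if b then y else n).
  have p2N n y : n \in N -> y \in N -> p2 n y \in N.
    by move=> nN yN; apply: (pN) => -[].
  have p2al n n' y y' : (n, n') \in al -> (y, y') \in al -> (p2 n y, p2 n' y') \in al.
    by move=> H K; apply: (con_pol _ Hp) => // -[].
  have pq n y (c : qcar al N) (nN : n \in N) (yN : y \in N) : (n, qrep c) \in al ->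
      (p2 n y, qrep (f (fun b => if b then qcls al yN else c))) \in al.
    move=> nc; rewrite fE; apply: (alT _ (alS (qrep_qcls Hal _))).
    apply: (con_pol _ Hp) => // -[] //; apply: alS; exact: (qrep_qcls Hal).
  have abs y : y \in N -> (z v, p2 (z v) y) \in al.
    move=> yN; have := pq _ _ _ (zN v) yN (alS (qrep_qcls Hal (zN v))).
    by rewrite fc => H; apply: alS; apply: alT H (qrep_qcls Hal _).
  pose n' := qrep c'; have n'N : n' \in N by apply: qrep_in.
  have neu y : y \in N -> (p2 n' y, y) \in al.
    move=> yN; have := pq _ _ _ n'N yN (alR _).
    by rewrite fc' => H; apply: alT H (qrep_qcls Hal _).
  pose sg y := e (p2 n' y).
  have Hp2 n : upol s (fun y => e (p2 n y)).
    apply: upol_comp He _.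
    apply: (pol_upol (g := fun (b : bool) y => if b then y else n) Hp).
    by case; [exact: upol_id | exact: pol_cst].
  have [a [b [aN bN ab]]] := trace_nontrivial.
  have sgN y : y \in N -> sg y \in N /\ (sg y, y) \in al.
    by move=> yN; rewrite /sg eid ?trace_sub ?p2N ?neu.
  have sgab : (sg a, sg b) \notin al.
    apply: contra ab => H; have [_ Ha] := sgN a aN; have [_ Hb] := sgN b bN.
    exact: alT (alS Ha) (alT H Hb).
  have [k kid] := noncollapsing_inv cov minU (Hp2 n') (fun y => eU _) (trace_sub aN)
    (trace_sub bN) (trace_be aN bN) sgab.
  have [sga _] := sgN a aN.
  have itN y : y \in N -> iter k sg y \in N.
    exact: (trace_stable (Hp2 n') (fun y => eU _) aN sga).
  exists (fun y => e (p2 (z v) (iter k sg y))); split.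
  - exact: (upol_comp (Hp2 (z v)) (upol_iter k (Hp2 n'))).
  - apply: tail_al => //; rewrite -{1}(kid t tail_in) /=.
    apply: (con_upol Hbe He); apply: (con_pol Hbe Hp) => -[] //.
    exact: trace_be.
  - move=> y yN; rewrite eid; first exact: abs (itN _ yN).
    by apply: trace_sub; apply: p2N => //; apply: itN.
have [k HkV] := choice Hk.
have [a [b [aN bN /negP[]]]] := trace_nontrivial.
have H : (Q (ja a (k^~ a)), Q (ja b (k^~ b))) \in al.
  by apply: substitution_absurd => // v; case: (HkV v).
have E c : c \in N -> (c, Q (ja c (k^~ c))) \in al.
  move=> cN; rewrite -{1}(Qid (trace_sub cN)); apply: Qal => // v.
  by case: (HkV v) => _ _; apply.
exact: alT (E _ aN) (alT H (alS (E _ bN))).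
Qed.

Lemma normalized_obstruction : False.
Proof.
have [] := type_properties Hty.
- exact: term_condition_absurd.
- exact: diagonal_dependence_absurd.
- exact: absorbing_products_absurd.
Qed.

End NormalizedObstruction.

Lemma tail_obstruction (V : finType) (P : ('I_1 + V -> T) -> T) (z : V -> T) a b :
  pol s P -> (forall x, P x \in U) -> (forall v, z v \in N) -> a \in N -> b \in N ->
  P (join_args (fun=> a) z) \in N -> P (fun=> t) \in N ->
  (P (join_args (fun=> a) z), P (join_args (fun=> b) z)) \in al.
Proof.
move=> HP PU zN aN bN PaN Pt; apply: contraT => Pab.
pose f x := P (join_args (fun=> x) z).
have Hf : upol s f.
  apply: (pol_comp (g := fun w (x : 'I_1 -> T) => join_args (fun=> x ord0) z w) HP).
  by case=> [w|v]; [exact: pol_var | exact: pol_cst].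
have [k kid] := noncollapsing_inv cov minU Hf (fun x => PU _) (trace_sub aN)
  (trace_sub bN) (trace_be aN bN) Pab.
case: (@normalized_obstruction V (fun x => iter k f (P x)) z) => //.
- exact: upol_pol (upol_iter k Hf) HP.
- by move=> x; apply: iter_range => // y; apply: PU.
- by move=> x xU; rewrite -[RHS](kid x xU) iterSr.
- exact: (trace_stable Hf (fun x => PU _) aN PaN).
Qed.

End Tail.

Section SquareSubalgebra.
Variables (T : finType) (A : alg_on T) (N : {set T}) (t : T).

Let V : finType := {x : T | x \in N}.

(* The subalgebra of A^2 generated by the diagonal and N x {t}. *)
Definition tail_sub : {set T * T} :=
  [set ab | `[< exists2 p : (V -> T) -> T, pol A p & ab = (p val, p (fun=> t)) >]].

Lemma tail_subP ab :
  ab \in tail_sub <-> exists2 p : (V -> T) -> T, pol A p & ab = (p val, p (fun=> t)).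
Proof. by rewrite inE; split=> [/asboolP|H]; last apply/asboolP. Qed.

Lemma tail_sub_closed : is_subuniverse (sq_alg A) tail_sub.
Proof.
move=> i x xS.
have {}xS j : exists p : (V -> T) -> T, pol A p /\ x j = (p val, p (fun=> t)).
  by have /tail_subP [p Hp Ex] := xS j; exists p.
have [p Hp] := choice xS.
apply/tail_subP; exists (fun y => @fn _ A i (fun j => p j y)).
  by apply: pol_app => j; case: (Hp j).
by congr pair; congr fn; apply: funext => j; case: (Hp j) => _ ->.
Qed.

Definition tsq : finType := {x : T * T | x \in tail_sub}.
Definition tsq_alg : alg_on tsq := sub_alg tail_sub_closed.

Definition pr1 (x : tsq) := (val x).1.
Definition pr2 (x : tsq) := (val x).2.

Lemma diag_in a : (a, a) \in tail_sub.
Proof. by apply/tail_subP; exists (fun=> a); first exact: pol_cst. Qed.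
Definition diag a : tsq := exist _ (a, a) (diag_in a).

Lemma gen_in a : a \in N -> (a, t) \in tail_sub.
Proof.
by move=> aN; apply/tail_subP; exists (fun x => x (exist _ a aN)); first exact: pol_var.
Qed.
Definition gen a (aN : a \in N) : tsq := exist _ (a, t) (gen_in aN).

Lemma pol_tsqP W (f : (W -> tsq) -> tsq) : pol tsq_alg f ->
  exists2 p : (W + V -> T) -> T, pol A p & forall x,
    pr1 (f x) = p (join_args (fun w => pr1 (x w)) val) /\
    pr2 (f x) = p (join_args (fun w => pr2 (x w)) (fun=> t)).
Proof.
elim=> [w|[a aS]|i g _ IH].
- by exists (fun x => x (inl w)); first exact: pol_var.
- have [p Hp E] := (tail_subP _).1 aS; exists (fun x => p (fun v => x (inr v))).
    exact: (pol_comp (g := fun v (x : W + V -> T) => x (inr v)) Hp (fun v => pol_var _ _)).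
  by rewrite /pr1 /pr2 /= E.
- have {}IH j : exists p : (W + V -> T) -> T, pol A p /\ forall x,
      pr1 (g j x) = p (join_args (fun w => pr1 (x w)) val) /\
      pr2 (g j x) = p (join_args (fun w => pr2 (x w)) (fun=> t)).
    by have [p Hp E] := IH j; exists p.
  have [p Hp] := choice IH.
  exists (fun x => @fn _ A i (fun j => p j x)).
    by apply: pol_app => j; case: (Hp j).
  move=> x; split; rewrite /pr1 /pr2 /=; congr fn; apply: funext => j;
    by have [_ /(_ x) []] := Hp j.
Qed.

Lemma pr1_pol W (f : (W -> tsq) -> tsq) : pol tsq_alg f ->
  exists2 p : (W -> T) -> T, pol A p & forall x, pr1 (f x) = p (fun w => pr1 (x w)).
Proof.
move=> /pol_tsqP [p Hp E].
exists (fun x => p (join_args x val)).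
  apply: (pol_comp (g := fun w (x : W -> T) => join_args x val w) Hp).
  by case=> [w|v]; [exact: pol_var | exact: pol_cst].
by move=> x; case: (E x).
Qed.

Lemma pol_lift W (p : (W -> T) -> T) : pol A p ->
  exists2 f : (W -> tsq) -> tsq, pol tsq_alg f & forall x,
    pr1 (f x) = p (fun w => pr1 (x w)) /\ pr2 (f x) = p (fun w => pr2 (x w)).
Proof.
elim=> [w|a|i g _ IH].
- by exists (fun x => x w); first exact: pol_var.
- by exists (fun=> diag a); first exact: pol_cst.
- have {}IH j : exists f : (W -> tsq) -> tsq, pol tsq_alg f /\ forall x,
      pr1 (f x) = g j (fun w => pr1 (x w)) /\ pr2 (f x) = g j (fun w => pr2 (x w)).
    by have [f Hf E] := IH j; exists f.
  have [f Hf] := choice IH.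
  exists (fun x => @fn _ tsq_alg i (fun j => f j x)).
    by apply: (@pol_app _ tsq_alg) => j; case: (Hf j).
  move=> x; split; rewrite /pr1 /pr2 /=; congr fn; apply: funext => j;
    by have [_ /(_ x) []] := Hf j.
Qed.

Lemma upol_lift p : upol A p -> exists2 f, upol tsq_alg f & forall x,
  pr1 (f x) = p (pr1 x) /\ pr2 (f x) = p (pr2 x).
Proof.
case/pol_lift => f Hf E; exists (fun x => f (fun=> x)); last by move=> x; apply: E.
exact: (pol_upol (g := fun _ x => x) Hf (fun _ => upol_id _)).
Qed.

Lemma pol_pr1_diag W (f : (W -> tsq) -> tsq) : pol tsq_alg f ->
  pol A (fun x => pr1 (f (fun w => diag (x w)))).
Proof.
case/pr1_pol => p Hp E; rewrite (_ : (fun _ => _) = p) //.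
by apply: funext => x; rewrite E.
Qed.

Lemma upol_pr1_diag f : upol tsq_alg f -> upol A (fun x => pr1 (f (diag x))).
Proof. exact: pol_pr1_diag. Qed.

Definition pull1 (C : {set T * T}) : {set tsq * tsq} :=
  [set xy | (pr1 xy.1, pr1 xy.2) \in C].
Definition pull2 (C : {set T * T}) : {set tsq * tsq} :=
  [set xy | (pr2 xy.1, pr2 xy.2) \in C].
Definition pull_diag (C : {set tsq * tsq}) : {set T * T} :=
  [set xy | (diag xy.1, diag xy.2) \in C].

Lemma pull1_con C : is_con A C -> is_con tsq_alg (pull1 C).
Proof.
case=> R S Tr O; split=> [x|x y|x y z|i x y H]; rewrite !inE //=.
- exact: S.
- exact: Tr.
- by apply: O => j; have := H j; rewrite inE.
Qed.

Lemma pull2_con C : is_con A C -> is_con tsq_alg (pull2 C).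
Proof.
case=> R S Tr O; split=> [x|x y|x y z|i x y H]; rewrite !inE //=.
- exact: S.
- exact: Tr.
- by apply: O => j; have := H j; rewrite inE.
Qed.

Lemma pull_diag_con C : is_con tsq_alg C -> is_con A (pull_diag C).
Proof.
case=> R S Tr O; split=> [x|x y|x y z|i x y H]; rewrite !inE //=.
- exact: S.
- exact: Tr.
- have fnd (u : 'I_(ar i) -> T) :
      diag (fn i u) = @fn _ tsq_alg i (fun j => diag (u j)) by apply: val_inj.
  by rewrite !fnd; apply: O => j; have := H j; rewrite inE.
Qed.

End SquareSubalgebra.

Section Pentagon.
Variables (T : finType) (A : alg_on T) (al be : {set T * T}) (U N : {set T}) (t : T).
Hypotheses (cov : covers A al be) (minU : minimal_set A al be U).
Hypotheses (trN : is_trace al be U N) (tail_t : t \in tail al be U).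
Variable ty : tct_type.
Hypothesis Hty : has_tct_type (induced_quot A al N) ty.
Variable e : T -> T.
Hypotheses (He : upol A e) (eU : forall x, e x \in U) (eid : forall x, x \in U -> e x = x).

Local Notation sa := (tsq_alg A N t).
Local Notation S := (tsq A N t).
Local Notation pr1 := (@pr1 T A N t).
Local Notation pr2 := (@pr2 T A N t).
Local Notation diag := (@diag T A N t).
Local Notation gen := (@gen T A N t).
Local Notation pull1 := (@pull1 T A N t).
Local Notation pull2 := (@pull2 T A N t).

Let Hal : is_con A al. Proof. by case: cov. Qed.
Let Hbe : is_con A be. Proof. by case: cov. Qed.
Let albe x y : (x, y) \in al -> (x, y) \in be.
Proof. by case: cov => _ _ /properP [/subsetP sab _] _ /sab. Qed.
Let alR x : (x, x) \in al. Proof. by case: Hal => + _ _ _; apply. Qed.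
Let alS x y : (x, y) \in al -> (y, x) \in al. Proof. by case: Hal => _ + _ _; apply. Qed.
Let alT x y z : (x, y) \in al -> (y, z) \in al -> (x, z) \in al.
Proof. by case: Hal => _ _ + _; apply. Qed.
Let beR x : (x, x) \in be. Proof. by case: Hbe => + _ _ _; apply. Qed.
Let beS x y : (x, y) \in be -> (y, x) \in be. Proof. by case: Hbe => _ + _ _; apply. Qed.
Let beT x y z : (x, y) \in be -> (y, z) \in be -> (x, z) \in be.
Proof. by case: Hbe => _ _ + _; apply. Qed.

Let NU x : x \in N -> x \in U. Proof. exact: (trace_sub trN). Qed.
Let Nbe x y : x \in N -> y \in N -> (x, y) \in be. Proof. exact: (trace_be cov trN). Qed.
Let Nclosed x y : x \in N -> y \in U -> (x, y) \in be -> y \in N.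
Proof. exact: (trace_closed cov trN). Qed.

Definition inU (x : S) := (pr1 x \in U) && (pr2 x \in U).
Definition inN (x : S) := (pr1 x \in N) && (pr2 x \in N).

Definition bb : {set S * S} := pull1 be :&: pull2 be.

Lemma bbE x y : ((x, y) \in bb) = ((pr1 x, pr1 y) \in be) && ((pr2 x, pr2 y) \in be).
Proof. by rewrite !inE. Qed.

Lemma bb_con : is_con sa bb.
Proof. exact: con_setI (pull1_con _ _ Hbe) (pull2_con _ _ Hbe). Qed.

(* The largest congruence below [bb] restricting to [al] (on first coordinates)
   inside N x N. *)
Definition de : {set S * S} :=
  [set xy | (xy \in bb) && `[< forall f, upol sa f -> (forall z, inU (f z)) ->
    inN (f xy.1) -> (pr1 (f xy.1), pr1 (f xy.2)) \in al >]].

Lemma deP x y : (x, y) \in de <-> (x, y) \in bb /\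
  forall f, upol sa f -> (forall z, inU (f z)) -> inN (f x) -> (pr1 (f x), pr1 (f y)) \in al.
Proof.
rewrite inE; split=> [/andP [-> /asboolP] //|[-> H]] /=; exact/asboolP.
Qed.

Lemma inN_bb x y : inN x -> inU y -> (x, y) \in bb -> inN y.
Proof.
rewrite bbE => /andP [x1 x2] /andP [y1 y2] /andP [b1 b2].
by rewrite /inN (Nclosed x1 y1 b1) (Nclosed x2 y2 b2).
Qed.

Lemma de_con : is_con sa de.
Proof.
have [R S' Tr _] := bb_con; apply: con_of_upol.
- by move=> x; apply/deP; split.
- move=> x y /deP [b H]; apply/deP; split; first exact: S'.
  move=> f Hf fU fyN; apply/alS/H => //; apply: (inN_bb fyN) => //.
  by apply: (con_upol bb_con Hf); apply: S'.
- move=> x y z /deP [bxy H] /deP [byz K]; apply/deP; split; first exact: Tr bxy byz.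
  move=> f Hf fU fxN; apply: alT (H f Hf fU fxN) (K f Hf fU _).
  exact: (inN_bb fxN (fU _) (con_upol bb_con Hf bxy)).
- move=> f x y Hf /deP [b H]; apply/deP; split; first exact: con_upol bb_con Hf b.
  by move=> g Hg gU; apply: (H (g \o f) (upol_comp Hg Hf)) => z; apply: gU.
Qed.

Let deR x : (x, x) \in de. Proof. by case: de_con => + _ _ _; apply. Qed.
Let deS x y : (x, y) \in de -> (y, x) \in de. Proof. by case: de_con => _ + _ _; apply. Qed.
Let deT x y z : (x, y) \in de -> (y, z) \in de -> (x, z) \in de.
Proof. by case: de_con => _ _ + _; apply. Qed.

Lemma de_of_al x y : (pr1 x, pr1 y) \in al -> (pr2 x, pr2 y) \in be -> (x, y) \in de.
Proof.
move=> H K; apply/deP; split; first by rewrite bbE albe.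
by move=> f /pr1_pol [p Hp E] _ _; rewrite !E; apply: (con_pol Hal Hp).
Qed.

Lemma gen_de a b (aN : a \in N) (bN : b \in N) : (gen aN, gen bN) \in de.
Proof.
apply/deP; split; first by rewrite bbE /= Nbe ?beR.
move=> f Hf fU; have [p Hp E] := pol_tsqP Hf.
have [E1 E2] := E (fun=> gen aN); have [E3 _] := E (fun=> gen bN).
have /andP [f1U f2U] := fU (gen aN); have /andP [f3U _] := fU (gen bN).
rewrite /inN E1 E2 E3 /=; rewrite E1 E2 E3 in f1U f2U f3U.
rewrite -(eid f1U) -(eid f2U) -(eid f3U) => /andP [f1N f2N].
apply: (tail_obstruction cov minU trN tail_t Hty (P := fun x => e (p x))) => //.
- exact: upol_pol He Hp.
- by move=> v; apply: valP.
- by congr (e (p _) \in N): f2N; apply: funext; case.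
Qed.

Lemma diag_de a b : a \in N -> b \in N -> (diag a, diag b) \in de -> (a, b) \in al.
Proof.
move=> aN bN /deP [_ H]; have [f Hf E] := upol_lift N t He.
have := H f Hf _ _; rewrite /inU /inN; case: (E (diag a)) => -> ->; case: (E (diag b)) => -> _.
rewrite /= !eid ?NU // aN; apply=> // z.
by case: (E z) => -> ->; rewrite !eU.
Qed.

Lemma inN_diag x : inN x -> (x, diag (pr1 x)) \in de.
Proof. by case/andP => x1 x2; apply: de_of_al; [exact: alR | exact: Nbe]. Qed.

Lemma al_diag a b : (a, b) \in al -> (diag a, diag b) \in de.
Proof. by move=> ab; apply: de_of_al => //=; apply: albe. Qed.

Lemma diag_bb a b : (a, b) \in be -> (diag a, diag b) \in bb.
Proof. by move=> ab; rewrite bbE ab. Qed.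

Lemma de_max C x y : is_con sa C -> de \subset C -> (x, y) \in C -> (x, y) \in bb ->
  (x, y) \notin de -> forall a b, a \in N -> b \in N -> (diag a, diag b) \in C.
Proof.
move=> HC /subsetP dC xyC xyb xyd a b aN bN.
have [_ CS CT _] := HC.
have [f Hf [fU [fxN fxy]]] : exists2 f, upol sa f & (forall z, inU (f z)) /\
    (inN (f x) /\ (pr1 (f x), pr1 (f y)) \notin al).
  apply: contrapT => H; case/negP: xyd; apply/deP; split=> // f Hf fU fxN.
  by apply: contrapT => /negP K; apply: H; exists f.
have fyN : inN (f y) := inN_bb fxN (fU _) (con_upol bb_con Hf xyb).
have H : (pr1 (f x), pr1 (f y)) \in pull_diag C.
  rewrite inE /=; apply: (CT _ _ _ (dC _ (deS (inN_diag fxN)))).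
  exact: (CT _ _ _ (con_upol HC Hf xyC) (dC _ (inN_diag fyN))).
have alC : al \subset pull_diag C.
  by apply/subsetP => -[c d] cd; rewrite inE; apply/dC/al_diag.
have /andP [fx1 _] := fxN; have /andP [fy1 _] := fyN.
have /subsetP /(_ (a, b)) := minimal_cover cov (pull_diag_con HC) alC H (Nbe fx1 fy1) fxy.
by rewrite inE; apply; apply: Nbe.
Qed.

Definition th : {set S * S} :=
  [set xy | `[< forall C, is_con sa C -> de \subset C ->
    (forall a b, a \in N -> b \in N -> (diag a, diag b) \in C) -> xy \in C >]].

Lemma thP xy : xy \in th <-> forall C, is_con sa C -> de \subset C ->
  (forall a b, a \in N -> b \in N -> (diag a, diag b) \in C) -> xy \in C.
Proof. by rewrite inE; split=> [/asboolP //|H]; apply/asboolP. Qed.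

Lemma th_con : is_con sa th.
Proof.
split.
- by move=> x; apply/thP => C [R _ _ _] _ _.
- by move=> x y /thP H; apply/thP => C HC d n; have [_ + _ _] := HC; apply; exact: H.
- move=> x y z /thP H /thP K; apply/thP => C HC d n; have [_ _ + _] := HC.
  by apply; [exact: H | exact: K].
- move=> i x y H; apply/thP => C HC d n; have [_ _ _] := HC; apply=> j.
  by have /thP := H j; apply.
Qed.

Lemma th_least C : is_con sa C -> de \subset C ->
  (forall a b, a \in N -> b \in N -> (diag a, diag b) \in C) -> th \subset C.
Proof. by move=> HC d n; apply/subsetP => xy /thP; apply. Qed.

Lemma de_bb : de \subset bb.
Proof. by apply/subsetP => -[x y] /deP []. Qed.

Lemma de_th : de \subset th.
Proof. by apply/subsetP => xy H; apply/thP => C _ /subsetP d _; apply: d. Qed.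

Lemma diag_th a b : a \in N -> b \in N -> (diag a, diag b) \in th.
Proof. by move=> aN bN; apply/thP => C _ _; apply. Qed.

Lemma th_bb : th \subset bb.
Proof. by apply: th_least de_bb _; [exact: bb_con | move=> a b aN bN; apply/diag_bb/Nbe]. Qed.

Lemma covers_de_th : covers sa de th.
Proof.
split; [exact: de_con | exact: th_con | |].
  apply/properP; split; first exact: de_th.
  have [a [b [aN bN /negP ab]]] := trace_nontrivial cov trN.
  by exists (diag a, diag b); [exact: diag_th | apply/negP => /(diag_de aN bN)].
move=> C HC dC Ct; have [Cd|/subsetPn [[x y] xyC xyd]] := boolP (C \subset de).
  by left; apply/eqP; rewrite eqEsubset Cd.
right; apply/eqP; rewrite eqEsubset Ct /=; apply: th_least => //.
apply: (de_max HC dC xyC _ xyd).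
exact: (subsetP th_bb _ (subsetP Ct _ xyC)).
Qed.

Lemma join_pull1 : is_join sa (pull1 al) de (pull1 be).
Proof.
split; first exact: pull1_con.
- by apply/subsetP => -[x y]; rewrite !inE; apply: albe.
- by apply: subset_trans de_bb _; apply: subsetIl.
move=> C HC /subsetP gC /subsetP dC; apply/subsetP => -[x y]; rewrite inE /= => xy.
have [_ CS CT _] := HC.
have gaC u v : (pr1 u, pr1 v) \in al -> (u, v) \in C by move=> H; apply: gC; rewrite inE.
have [a [b [aN bN ab]]] := trace_nontrivial cov trN.
have abC : (a, b) \in pull_diag C.
  rewrite inE /=; apply: (CT _ _ _ (gaC (diag a) (gen aN) (alR _))).
  exact: (CT _ _ _ (dC _ (gen_de aN bN)) (gaC (gen bN) (diag b) (alR _))).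
have alC : al \subset pull_diag C.
  by apply/subsetP => -[c d] cd; rewrite inE; apply: gaC.
have /subsetP /(_ _ xy) := minimal_cover cov (pull_diag_con HC) alC abC (Nbe aN bN) ab.
rewrite inE /= => H; apply: (CT _ _ _ (gaC x (diag (pr1 x)) (alR _))).
exact: (CT _ _ _ H (gaC (diag (pr1 y)) y (alR _))).
Qed.

Lemma pull1_th_de : pull1 al :&: th \subset de.
Proof.
apply/subsetP => -[x y]; rewrite inE => /andP [xy /(subsetP th_bb)].
by rewrite bbE => /andP [_]; apply: de_of_al; move: xy; rewrite inE.
Qed.

Lemma pentagon_card : #|[set pull1 al :&: de; pull1 al; de; th; pull1 be]| = 5.
Proof.
have [a [b [aN bN ab]]] := trace_nontrivial cov trN.
have ta : (a, t) \notin be.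
  by apply/negP => /beS; apply/negP; exact: (tail_trace_be cov trN tail_t aN).
have w1b : (diag a, gen aN) \notin bb by rewrite bbE /= (negPf ta) andbF.
have w1d : (diag a, gen aN) \notin de by apply: contra w1b; apply: (subsetP de_bb).
have w1t : (diag a, gen aN) \notin th by apply: contra w1b; apply: (subsetP th_bb).
have w1g : (diag a, gen aN) \in pull1 al by rewrite inE.
have w1J : (diag a, gen aN) \in pull1 be by rewrite inE.
have w2d : (gen aN, gen bN) \in de := gen_de aN bN.
have w2t : (gen aN, gen bN) \in th := subsetP de_th _ w2d.
have w2g : (gen aN, gen bN) \notin pull1 al by rewrite inE.
have w2J : (gen aN, gen bN) \in pull1 be by rewrite inE /= Nbe.
have w3t : (diag a, diag b) \in th := diag_th aN bN.
have w3d : (diag a, diag b) \notin de by apply: contra ab; apply: diag_de.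
have ne (X Y : {set S * S}) w : w \in X -> w \notin Y -> (Y == X) = false.
  by move=> H K; apply/eqP => E; rewrite E H in K.
have nI (X Y : {set S * S}) w : w \notin X -> w \notin Y :&: X.
  by rewrite inE negb_and orbC => ->.
have nI' (X Y : {set S * S}) w : w \notin Y -> w \notin Y :&: X.
  by rewrite inE negb_and => ->.
have -> : [set pull1 al :&: de; pull1 al; de; th; pull1 be] =
    [set:: [:: pull1 al :&: de; pull1 al; de; th; pull1 be]].
  by apply/setP => X; rewrite !inE -!orbA.
rewrite cardsE (card_uniqP _) //= !inE.
rewrite (ne _ _ _ w1g (nI _ _ _ w1d)) (ne _ _ _ w2d (nI' _ _ _ w2g)).
rewrite (ne _ _ _ w2t (nI' _ _ _ w2g)) (ne _ _ _ w2J (nI' _ _ _ w2g)).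
rewrite (ne _ _ _ w2d w2g) (ne _ _ _ w2t w2g) (ne _ _ _ w2J w2g).
by rewrite (ne _ _ _ w3t w3d) (ne _ _ _ w1J w1d) (ne _ _ _ w1J w1t).
Qed.

Lemma th_minimal_set : exists M : {set S}, minimal_set sa de th M /\
  exists f, [/\ upol sa f, forall x, f x \in M, forall x, x \in M -> f x = x &
    forall x, x \in M -> inU x].
Proof.
have [E HE Ee] := upol_lift N t He.
have Eid x : inU x -> E x = x.
  case/andP => x1 x2; have [E1 E2] := Ee x; apply: val_inj.
  by rewrite [LHS]surjective_pairing [RHS]surjective_pairing; congr pair;
    rewrite -/(pr1 _) -/(pr2 _) ?E1 ?E2 eid.
have EU x : inU (E x) by rewrite /inU; case: (Ee x) => -> ->; rewrite !eU.
pose good (M : {set S}) :=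
  [/\ poly_image sa M, separates de th M & M \subset E @: [set: S]].
have good0 : good (E @: [set: S]).
  split=> //.
    by exists E; split=> [||]; [exact/upolE | move=> x; rewrite Eid | ].
  have [a [b [aN bN /negP ab]]] := trace_nontrivial cov trN.
  have dE c : c \in N -> diag c = E (diag c) by move=> cN; rewrite Eid // /inU /= NU.
  apply/(separatesP covers_de_th); exists (diag a), (diag b); split.
  - by rewrite (dE a aN); apply: imset_f.
  - by rewrite (dE b bN); apply: imset_f.
  - exact: diag_th.
  - by apply/negP => /(diag_de aN bN).
have [M /asboolP [[f [/upolE Hf ff ->]] Ms /subsetP ME] Mmin] :=
  @arg_minnP _ (E @: [set: S]) (fun M => `[< good M >]) (fun M => #|M|) (asboolT good0).
exists (f @: [set: S]); split.
  split=> //; first by exists f; split=> //; apply/upolE.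
  move=> W HW Ws Wf; apply/eqP; rewrite eqEcard Wf; apply: Mmin; apply/asboolP.
  by split=> //; apply: subset_trans Wf _; apply/subsetP.
exists f; split=> // [x|x|x].
- exact: imset_f.
- by case/imsetP => y _ ->.
- by move=> /ME /imsetP [y _ ->].
Qed.

Lemma cover_type_de_th : cover_type sa de th ty.
Proof.
have [M [minM [f [Hf fM fid MU]]]] := th_minimal_set.
have [_ thS thT _] := th_con.
have [p Hp [a [b [aN bN fpab]]]] : exists2 p, upol sa p &
    exists a b, [/\ a \in N, b \in N & (f (p (diag a)), f (p (diag b))) \notin de].
  have [_ /(separatesP covers_de_th) [x [y [xM yM xyt xyd]]] _] := minM.
  apply: contrapT => H; case/negP: xyd.
  have /subsetP /(_ _ xyt) : th \subset separator sa f de.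
    apply: th_least; [exact: separator_con de_con | exact: con_sub_separator de_con Hf | ].
    move=> a b aN bN; apply/separatorP => p Hp; apply: contrapT => /negP K.
    by apply: H; exists p => //; exists a, b.
  by move=> /separatorP /(_ _ (@upol_id _ sa)); rewrite !fid.
pose h x := f (p x).
have Hh : upol sa h := upol_comp Hf Hp.
have hM x : h x \in M by apply: fM.
have hU x : inU (h x) by apply: MU.
have dbb c d : c \in N -> d \in N -> (diag c, diag d) \in bb by move=> cN dN; apply/diag_bb/Nbe.
have hbb c d : c \in N -> d \in N -> (h (diag c), h (diag d)) \in bb.
  by move=> cN dN; apply: (con_upol bb_con Hh (dbb _ _ cN dN)).
have hal c d : (c, d) \in al -> (h (diag c), h (diag d)) \in de.
  by move=> cd; apply: (con_upol de_con Hh (al_diag cd)).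
have [g Hg [gU [ghN ghab]]] : exists2 g, upol sa g & (forall z, inU (g z)) /\
    (inN (g (h (diag a))) /\ (pr1 (g (h (diag a))), pr1 (g (h (diag b)))) \notin al).
  apply: contrapT => H; case/negP: fpab; apply/deP; split; first exact: (hbb a b).
  by move=> g Hg gU gN; apply: contrapT => /negP K; apply: H; exists g.
have /andP [gh1 _] := ghN.
pose gh x := g (h x).
have Hgh : upol sa gh := upol_comp Hg Hh.
pose pi x := pr1 (gh (diag x)).
have Hpi : upol A pi := upol_pr1_diag Hgh.
have piU x : pi x \in U by case/andP: (gU (h (diag x))).
have [k kid] := noncollapsing_inv cov minU Hpi piU (NU aN) (NU bN) (Nbe aN bN) ghab.
have piN j x : x \in N -> iter j pi x \in N by apply: (trace_stable cov trN Hpi piU aN gh1).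
have ghpi x : x \in N -> (gh (diag x), diag (pi x)) \in de.
  move=> xN; apply: inN_diag; apply: (inN_bb ghN (gU _)).
  exact: con_upol bb_con Hgh (dbb a x aN xN).
have ghiter j x : x \in N -> (iter j gh (diag x), diag (iter j pi x)) \in de.
  move=> xN; elim: j => [|j IH] //.
  exact: deT (con_upol de_con Hgh IH) (ghpi _ (piN j x xN)).
(* [g'] inverts [h] on the diagonal of N x N, modulo [de]. *)
pose g' x := iter k gh (g x).
have Hg' : upol sa g' := upol_comp (upol_iter k Hgh) Hg.
have g'U x : inU (g' x) by rewrite /g'; case: (k) => [|j] /=; apply: gU.
have g'h x : x \in N -> (g' (h (diag x)), diag x) \in de.
  move=> xN; have := ghiter k.+1 x xN; rewrite kid; last exact: NU.
  by rewrite iterSr.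
pose eta x := pr1 (h (diag x)).
have Heta : upol A eta := upol_pr1_diag Hh.
have etaU x : eta x \in U by case/andP: (hU (diag x)).
have etaab : (eta a, eta b) \notin al.
  apply: contra fpab => H; apply: de_of_al => //.
  by have := hbb a b aN bN; rewrite bbE => /andP [].
have [l lid] := noncollapsing_inv cov minU Heta etaU (NU aN) (NU bN) (Nbe aN bN) etaab.
pose N' := [set y in M | (h (diag a), y) \in th].
have N'M y : y \in N' -> y \in M by rewrite inE => /andP [].
have N'th y : y \in N' -> (h (diag a), y) \in th by rewrite inE => /andP [].
have hN' x : x \in N -> h (diag x) \in N'.
  by move=> xN; rewrite inE hM /=; apply: (con_upol th_con Hh (diag_th aN xN)).
have N'h y : y \in N' -> exists2 x, x \in N & (y, h (diag x)) \in de.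
  move=> yN'; have := subsetP th_bb _ (N'th y yN'); rewrite bbE => /andP [b1 b2].
  have /andP [y1 y2] := MU _ (N'M y yN').
  have xN : iter l eta (pr1 y) \in N.
    apply: (Nclosed aN); first exact: iter_range.
    rewrite -{1}(lid a (NU aN)) iterSr; exact: (con_upol Hbe (upol_iter l Heta) b1).
  exists (iter l eta (pr1 y)) => //; apply: de_of_al.
    by rewrite -/(eta _) -iterS lid.
  have := hbb _ _ aN xN; rewrite bbE => /andP [_]; exact: beT (beS b2).
have trN' : is_trace de th M N'.
  apply/existsP; exists (h (diag a)); rewrite hM eqxx /=.
  apply/eqP => /setP /(_ (h (diag b))); rewrite (hN' b bN) inE hM (negPf fpab) //.
have g'N y : y \in N' -> inN (g' y).
  move=> /N'h [x xN yx]; apply: (@inN_bb (diag x)) => //; first by rewrite /inN /= xN.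
  apply: (subsetP de_bb); apply: deS; apply: deT (g'h _ xN).
  exact: con_upol de_con Hg' yx.
have g'N1 y : y \in N' -> pr1 (g' y) \in N by move=> /g'N /andP [].
have g'al y z : y \in N' -> z \in N' -> (y, z) \in de -> (pr1 (g' y), pr1 (g' z)) \in al.
  move=> yN zN yz; apply: diag_de; [exact: g'N1 | exact: g'N1 | ].
  apply: deT (deS (inN_diag (g'N y yN))) _; apply: deT _ (inN_diag (g'N z zN)).
  exact: con_upol de_con Hg' yz.
have g'hal x : x \in N -> (pr1 (g' (h (diag x))), x) \in al.
  move=> xN; apply: (diag_de (g'N1 _ (hN' _ xN)) xN).
  exact: deT (deS (inN_diag (g'N _ (hN' _ xN)))) (g'h _ xN).
have hg'de y : y \in N' -> (h (diag (pr1 (g' y))), y) \in de.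
  move=> yN; have [x xN yx] := N'h y yN; apply: deT (deS yx).
  apply: hal; apply: alT (g'hal x xN); apply: g'al => //; exact: hN'.
pose Phi (c : qcar al N) : qcar de N' := qcls de (hN' _ (qrep_in c)).
pose Psi (d : qcar de N') : qcar al N := qcls al (g'N1 _ (qrep_in d)).
have PhiE c : (qrep (Phi c), h (diag (qrep c))) \in de by apply: (qrep_qcls de_con).
have PsiE d : (qrep (Psi d), pr1 (g' (qrep d))) \in al by apply: (qrep_qcls Hal).
have K1 : cancel Phi Psi.
  move=> c; rewrite -[RHS]qcls_qrep; apply/(qcls_eq Hal).
  apply: alT (g'hal _ (qrep_in c)).
  by apply: g'al (PhiE c); [exact: qrep_in | exact: (hN' _ (qrep_in _))].
have K2 : cancel Psi Phi.
  move=> d; rewrite -[RHS]qcls_qrep; apply/(qcls_eq de_con).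
  exact: deT (hal _ _ (PsiE d)) (hg'de _ (qrep_in d)).
exists M; split=> //; exists N'; split=> //.
apply: (has_tct_type_transport K1 K2 _ Hty).
apply/poly_equivP => n F; rewrite (pol_transport _ _ K1 K2); split.
- case/(pol_quotP de_con) => q Hq [qN FE].
  pose G (x : 'I_n -> T) := pr1 (g' (q (fun w => h (diag (x w))))).
  have HG : pol A G.
    apply: (@pol_pr1_diag _ _ _ _ _ (fun y => g' (q (fun w => h (y w))))).
    apply: upol_pol Hg' _; apply: (pol_comp (g := fun w y => h (y w)) Hq) => w.
    exact: upol_pol Hh (pol_var _ _).
  have GN x : (forall w, x w \in N) -> G x \in N.
    by move=> xN; apply: (g'N1); apply: (qN) => w; apply: (hN').
  have := pol_quot al GN HG; congr pol; apply: funext => c; apply/(qcls_eq Hal).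
  apply: g'al; [by apply: (qN) => w; exact: (hN' _ (qrep_in _)) | exact: qrep_in | ].
  rewrite FE; apply: deS; apply: deT (qrep_qcls de_con _) _.
  by apply: (con_pol de_con Hq) => w; apply: PhiE.
- case/(pol_quotP Hal) => q Hq [qN FE].
  have [L HL LE] := pol_lift N t Hq.
  pose G (y : 'I_n -> S) := h (L (fun w => g' (y w))).
  have LN y : (forall w, y w \in N') -> inN (L (fun w => g' (y w))).
    move=> yN; rewrite /inN; case: (LE (fun w => g' (y w))) => -> ->.
    by apply/andP; split; apply: (qN) => w; case/andP: (g'N _ (yN w)).
  have HG : pol sa G.
    apply: upol_pol Hh _; apply: (pol_comp (g := fun w y => g' (y w)) HL) => w.
    exact: upol_pol Hg' (pol_var _ _).
  have Gde y : (forall w, y w \in N') ->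
      (G y, h (diag (q (fun w => pr1 (g' (y w)))))) \in de.
    move=> yN; apply: (con_upol de_con Hh); case: (LE (fun w => g' (y w))) => <- _.
    exact: inN_diag (LN y yN).
  have GN y : (forall w, y w \in N') -> G y \in N'.
    move=> yN; rewrite inE hM /=.
    apply: (thT _ (h (diag (q (fun w => pr1 (g' (y w))))))).
      by apply: N'th; apply: (hN'); apply: (qN) => w; apply: (g'N1).
    by apply: (subsetP de_th); apply: deS; apply: Gde.
  have := pol_quot de GN HG; congr pol; apply: funext => d.
  have -> : F d = Phi (qcls al (qN (fun w => qrep (Psi (d w))) (fun w => qrep_in (Psi (d w))))).
    rewrite -(FE (fun w => Psi (d w))) K2; congr F.
    by apply: funext => w /=; rewrite K2.
  apply/(qcls_eq de_con); apply: deT (Gde _ (fun w => qrep_in (d w))) _; apply: hal.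
  apply: alT _ (alS (qrep_qcls Hal _)).
  by apply: (con_pol Hal Hq) => w; apply/alS/PsiE.
Qed.

End Pentagon.

Theorem theorem2p4 (T : finType) (A : alg_on T) (al be : {set T * T})
    (U : {set T}) (t : tct_type) :
  covers A al be ->
  minimal_set A al be U ->
  min_set_type A al be U t ->
  tail al be U != set0 ->
  exists (S : {set T * T}) (HS : is_subuniverse (sq_alg A) S),
    exists ga de th : {set {x : T * T | x \in S} * {x : T * T | x \in S}},
      pentagon_of_type (sub_alg HS) ga de th t.
Proof.
move=> cov minU [N [trN Hty]] /set0Pn [u tail_u].
have [[e [/upolE He ee UE]] _ _] := minU.
have eU x : e x \in U by rewrite UE; apply: imset_f.
have eid x : x \in U -> e x = x by rewrite UE => /imsetP [y _ ->].
have [con_al con_be _ _] := cov.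
have cov' := covers_de_th u cov trN He eU eid.
have [con_de con_th _ _] := cov'.
exists (tail_sub A N u), (@tail_sub_closed T A N u).
exists (pull1 A N u al), (de A al be U N u), (th A al be U N u).
split; first by split; [exact: pull1_con | split].
- by case: cov' => _ _ + _.
- exact: (pull1_th_de u cov trN).
- exists (pull1 A N u be); split.
  + exact: (join_pull1 cov minU trN tail_u Hty He eU eid).
  + by apply: subset_trans (th_bb u cov trN) _; apply: subsetIl.
  + exact: (pentagon_card cov minU trN tail_u Hty He eU eid).
  + exact: cov'.
  + exact: (cover_type_de_th u cov minU trN Hty He eU eid).
Qed.
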